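(* Let $p>1$, let $\Gamma$ be a connected simple graph with $N$ vertices and let $F=\{f_i\}_{i=1}^N$ be an $\mathcal{L}_\Gamma(N,N-1)$-frame for $\mathbb{R}^{N-1}$. If $F$ is a tight frame, then $(F,S_F^{-1}F)\in\mathcal{O}_1^p$.
   Context: A sequence $F=\{f_i\}_{i=1}^N$ in an $n$-dimensional Hilbert space $\mathcal{H}$ is a frame if there are $A,B>0$ with $A\|f\|^2\le\sum_{i=1}^N|\langle f,f_i\rangle|^2\le B\|f\|^2$ for all $f\in\mathcal{H}$; it is tight if one can take $A=B$. Its analysis operator is $\Theta_F f=(\langle f,f_i\rangle)_{i=1}^N$, with adjoint $\Theta_F^*(c_i)_i=\sum_i c_if_i$; the frame operator is $S_F=\Theta_F^*\Theta_F$ (positive and invertible). A frame $G=\{g_i\}_{i=1}^N$ is a dual of $F$ if $f=\sum_{i=1}^N\langle f,f_i\rangle g_i$ for all $f$; then $(F,G)$ is an $(N,n)$ dual pair. The canonical dual is $S_F^{-1}F=\{S_F^{-1}f_i\}_{i=1}^N$. Let $\mathcal{D}^{(1)}$ be the set of $N\times N$ diagonal matrices with exactly one diagonal entry equal to $1$ and all others $0$. With $\|\cdot\|$ the operator norm, define $\mathcal{O}_1^p(F,G)=\Big\{\frac1N\sum_{D\in\mathcal{D}^{(1)}}\|\Theta_G^*D\Theta_F\|^p\Big\}^{1/p}$, $\Delta_1^p=\inf\{\mathcal{O}_1^p(F,G):(F,G)\text{ an }(N,n)\text{ dual pair}\}$, and let $\mathcal{O}_1^p$ be the set of $(N,n)$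 dual pairs with $\mathcal{O}_1^p(F,G)=\Delta_1^p$. (Superscript $p$ is an index, not a power.) Here $\mathcal{H}=\mathbb{R}^{N-1}$, $n=N-1$. For a simple graph $\Gamma$ on vertices $v_1,\dots,v_N$, the Laplacian is $\mathcal{L}(\Gamma)=\mathcal{D}(\Gamma)-\mathcal{A}(\Gamma)$, with $\mathcal{D}(\Gamma)$ the diagonal degree matrix and $\mathcal{A}(\Gamma)$ the adjacency matrix. If $\Gamma$ has $N-n$ connected components, write $\mathcal{L}(\Gamma)=M\,\mathrm{diag}(\lambda_1,\dots,\lambda_n,0,\dots,0)M^*$ with $\lambda_1,\dots,\lambda_n$ the nonzero eigenvalues and $M$ a unitary (here real orthogonal) matrix of corresponding eigenvectors; let $M_1$ consist of the first $n$ columns of $M$ and $B=\mathrm{diag}(\sqrt{\lambda_1},\dots,\sqrt{\lambda_n})M_1^*$. Any frame of the form $\{Be_i\}_{i=1}^N$, with $(e_i)$ the standard basis, is called an $\mathcal{L}_\Gamma(N,n)$-frame; its Gramian matrix $\Theta_F\Theta_F^*$ is $\mathcal{L}(\Gamma)$. *)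

(* Defs.v *)
From HB Require Import structures.
From mathcomp Require Import all_boot all_order all_algebra.
From mathcomp Require Import all_classical reals exp.
Set Implicit Arguments.
Unset Strict Implicit.
Unset Printing Implicit Defensive.
Import Order.TTheory GRing.Theory Num.Theory.
Local Open Scope classical_set_scope.
Local Open Scope ring_scope.

(** * Euclidean structure on R^n *)

(* The norm that MathComp-Analysis puts on matrices is the sup norm, so the
   Hilbert space structure of R^n = 'cV[R]_n is defined here. *)
Definition dot (R : realType) (n : nat) (x y : 'cV[R]_n) : R :=
  \sum_(i < n) x i 0 * y i 0.

Definition enorm (R : realType) (n : nat) (x : 'cV[R]_n) : R :=
  Num.sqrt (dot x x).

Definition opnorm (R : realType) (m n : nat) (A : 'M[R]_(m, n)) : R :=
  sup [set enorm (A *m x) | x in [set x : 'cV[R]_n | enorm x <= 1]].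

(** * Frames *)

Definition frame_bounds (R : realType) (N n : nat) (F : 'I_N -> 'cV[R]_n)
    (A B : R) : Prop :=
  forall f : 'cV[R]_n,
    A * enorm f ^+ 2 <= \sum_(i < N) `|dot f (F i)| ^+ 2 <= B * enorm f ^+ 2.

Definition is_frame (R : realType) (N n : nat) (F : 'I_N -> 'cV[R]_n) : Prop :=
  exists A B : R, [/\ 0 < A, 0 < B & frame_bounds F A B].

Definition tight_frame (R : realType) (N n : nat) (F : 'I_N -> 'cV[R]_n) :
    Prop :=
  exists2 A : R, 0 < A & frame_bounds F A A.

(* Matrices act on column vectors from the left; see [analysis_opE] and
   [synthesis_opE]. *)
Definition analysis_op (R : realType) (N n : nat) (F : 'I_N -> 'cV[R]_n) :
    'M[R]_(N, n) :=
  \matrix_(i < N, j < n) F i j 0.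

Lemma analysis_opE (R : realType) (N n : nat) (F : 'I_N -> 'cV[R]_n)
    (f : 'cV[R]_n) :
  analysis_op F *m f = \col_(i < N) dot f (F i).
Proof.
by apply/colP => i; rewrite !mxE; apply: eq_bigr => j _; rewrite mxE mulrC.
Qed.

Lemma synthesis_opE (R : realType) (N n : nat) (F : 'I_N -> 'cV[R]_n)
    (c : 'cV[R]_N) :
  (analysis_op F)^T *m c = \sum_(i < N) c i 0 *: F i.
Proof.
apply/colP => j; rewrite summxE mxE.
by apply: eq_bigr => i _; rewrite !mxE mulrC.
Qed.

Definition frame_op (R : realType) (N n : nat) (F : 'I_N -> 'cV[R]_n) :
    'M[R]_n :=
  (analysis_op F)^T *m analysis_op F.

(* [invmx] is the inverse of an invertible matrix; the frame operator of a frame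
   is invertible. *)
Definition canonical_dual (R : realType) (N n : nat) (F : 'I_N -> 'cV[R]_n) :
    'I_N -> 'cV[R]_n :=
  fun i => invmx (frame_op F) *m F i.

Definition dual_pair (R : realType) (N n : nat) (F G : 'I_N -> 'cV[R]_n) :
    Prop :=
  [/\ is_frame F, is_frame G &
      forall f : 'cV[R]_n, f = \sum_(i < N) dot f (F i) *: G i].

(** * Optimal dual pairs for one erasure *)

Definition erasures1 (R : realType) (N : nat) : set 'M[R]_N :=
  [set delta_mx i i | i in [set: 'I_N]].
Arguments erasures1 : clear implicits.

Definition error1 (R : realType) (N n : nat) (p : R)
    (F G : 'I_N -> 'cV[R]_n) : R :=
  (N%:R^-1 * \sum_(D \in erasures1 R N)
     opnorm ((analysis_op G)^T *m D *m analysis_op F) `^ p) `^ p^-1.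

Definition min_error1 (R : realType) (N n : nat) (p : R) : R :=
  inf [set error1 p FG.1 FG.2 | FG in
        [set FG : ('I_N -> 'cV[R]_n) * ('I_N -> 'cV[R]_n) |
          dual_pair FG.1 FG.2]].

Definition optimal_pairs1 (R : realType) (N n : nat) (p : R) :
    set (('I_N -> 'cV[R]_n) * ('I_N -> 'cV[R]_n)) :=
  [set FG | dual_pair FG.1 FG.2 /\
            error1 p FG.1 FG.2 = min_error1 N n p].
Arguments optimal_pairs1 {R} N n p.

(** * Graphs on the vertex set 'I_N and their frames *)

Definition simple_graph (N : nat) (e : rel 'I_N) : Prop :=
  symmetric e /\ irreflexive e.

(* The graph without vertices is not connected. *)
Definition connected_graph (N : nat) (e : rel 'I_N) : Prop :=
  (0 < N)%N /\ forall i j : 'I_N, connect e i j.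

Definition laplacian (R : realType) (N : nat) (e : rel 'I_N) : 'M[R]_N :=
  diag_mx (\row_(i < N) #|[pred j | e i j]|%:R) -
  \matrix_(i < N, j < N) (e i j)%:R.

(* [lambda] is the whole vector (lambda_1, ..., lambda_n, 0, ..., 0), and
   [colsub (widen_ord hn) M] consists of the first n columns of M. *)
Definition laplacian_frame (R : realType) (N n : nat) (hn : (n <= N)%N)
    (e : rel 'I_N) (F : 'I_N -> 'cV[R]_n) : Prop :=
  [/\ simple_graph e, n_comp e predT = (N - n)%N, is_frame F &
      exists (M : 'M[R]_N) (lambda : 'rV[R]_N),
        [/\ M *m M^T = 1%:M,
            forall i : 'I_N, (lambda 0 i != 0) = (i < n)%N,
            laplacian R e = M *m diag_mx lambda *m M^T &
            let B : 'M[R]_(n, N) :=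
              diag_mx (\row_(j < n) Num.sqrt (lambda 0 (widen_ord hn j)))
                *m (colsub (widen_ord hn) M)^T in
            forall i : 'I_N, F i = B *m (delta_mx i 0 : 'cV[R]_N)]].

(* Main.v *)
Require Import Defs.
From HB Require Import structures.
From mathcomp Require Import all_boot all_order all_algebra.
From mathcomp Require Import all_classical reals exp.
From mathcomp Require Import ring lra.
Import Order.TTheory GRing.Theory Num.Theory.
Local Open Scope classical_set_scope.
Local Open Scope ring_scope.

(** The error operator of a single erasure at [i] is the rank-one operator
    [f |-> <f, f_i> g_i], whose operator norm is [|f_i| |g_i|]
    ([opnorm_rank1]).  So the error of a dual pair is the power mean of
    exponent [p] of the numbers [|f_i| |g_i|] ([error1E]).

    Lower bound: for every dual pair the operator [f |-> sum_i <f, f_i> g_i] is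
    the identity; taking traces, [sum_i <f_i, g_i> = n] ([dual_pair_trace]).
    By Cauchy-Schwarz the numbers [|f_i| |g_i|] have sum at least [n], and the
    power mean inequality ([power_mean]) bounds the error below by [n / N]
    ([dual_pair_error1_ge]).

    The bound is attained: if [F] is tight with bound [A], its canonical dual is
    [A^-1 F], so that [|f_i| |g_i| = |f_i|^2 / A].  The Gram matrix of [F] is the
    Laplacian, whose nonzero eigenvalues are then all equal to [A]; as the
    constant vectors lie in its kernel, which is a line, the Laplacian is [A]
    times the projection onto the orthogonal complement of the constant vectors.
    Its diagonal entries [|f_i|^2] are thus all [A (N - 1) / N]
    ([tight_laplacian_frame_norm]), and every term of the power mean is
    [(N - 1) / N]. *)

(** * Inner product, norm and rank-one operators *)

Lemma dotC {R : realType} {n : nat} (x y : 'cV[R]_n) : dot x y = dot y x.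
Proof. by apply: eq_bigr => i _; rewrite mulrC. Qed.

Lemma dot_mulmx {R : realType} {n : nat} (x y : 'cV[R]_n) :
  dot x y = (x^T *m y) 0 0.
Proof. by rewrite mxE; apply: eq_bigr => i _; rewrite mxE. Qed.

Lemma dotDl {R : realType} {n : nat} (x y z : 'cV[R]_n) :
  dot (x + y) z = dot x z + dot y z.
Proof. by rewrite -big_split; apply: eq_bigr => i _; rewrite mxE mulrDl. Qed.

Lemma dotZl {R : realType} {n : nat} (a : R) (x y : 'cV[R]_n) :
  dot (a *: x) y = a * dot x y.
Proof. by rewrite mulr_sumr; apply: eq_bigr => i _; rewrite mxE mulrA. Qed.

Lemma dotZr {R : realType} {n : nat} (a : R) (x y : 'cV[R]_n) :
  dot x (a *: y) = a * dot x y.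
Proof. by rewrite dotC dotZl dotC. Qed.

Lemma dotDr {R : realType} {n : nat} (x y z : 'cV[R]_n) :
  dot x (y + z) = dot x y + dot x z.
Proof. by rewrite dotC dotDl !(dotC x). Qed.

Lemma dot0l {R : realType} {n : nat} (y : 'cV[R]_n) : dot 0 y = 0.
Proof. by rewrite /dot big1// => i _; rewrite mxE mul0r. Qed.

Lemma dot_ge0 {R : realType} {n : nat} (x : 'cV[R]_n) : 0 <= dot x x.
Proof. by apply: sumr_ge0 => i _; rewrite -expr2 sqr_ge0. Qed.

Lemma dot_eq0 {R : realType} {n : nat} {x : 'cV[R]_n} : dot x x = 0 -> x = 0.
Proof.
move=> x0; apply/colP => i; rewrite mxE; apply/eqP.
rewrite -sqrf_eq0 expr2; apply/eqP.
by apply: (psumr_eq0P _ x0) => // j _; rewrite -expr2 sqr_ge0.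
Qed.

Lemma enorm_ge0 {R : realType} {n : nat} (x : 'cV[R]_n) : 0 <= enorm x.
Proof. exact: sqrtr_ge0. Qed.

Lemma sqr_enorm {R : realType} {n : nat} (x : 'cV[R]_n) :
  enorm x ^+ 2 = dot x x.
Proof. by rewrite sqr_sqrtr// dot_ge0. Qed.

Lemma enormZ {R : realType} {n : nat} (a : R) (x : 'cV[R]_n) :
  enorm (a *: x) = `|a| * enorm x.
Proof.
by rewrite /enorm dotZl dotZr mulrA -expr2 sqrtrM ?sqr_ge0// sqrtr_sqr.
Qed.

Lemma enorm_eq0 {R : realType} {n : nat} (x : 'cV[R]_n) :
  (enorm x == 0) = (x == 0).
Proof.
apply/eqP/eqP => [x0|->]; last by rewrite /enorm dot0l sqrtr0.
by apply: dot_eq0; rewrite -sqr_enorm x0 expr0n.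
Qed.

Lemma enorm0 {R : realType} {n : nat} : enorm (0 : 'cV[R]_n) = 0.
Proof. by apply/eqP; rewrite enorm_eq0. Qed.

Lemma Cauchy_Schwarz_sqr {R : realType} {n : nat} (x y : 'cV[R]_n) :
  dot x y ^+ 2 <= dot x x * dot y y.
Proof.
have [y0|ynz] := eqVneq (dot y y) 0.
  by rewrite (dot_eq0 y0) dotC !dot0l expr0n mulr0.
have ygt0 : 0 < dot y y by rewrite lt_def ynz dot_ge0.
(* |y|^2 x - <x,y> y is a multiple of the component of x orthogonal to y *)
have := dot_ge0 (dot y y *: x + (- dot x y) *: y).
rewrite !dotDl !dotDr !dotZl !dotZr (dotC y x) => h.
rewrite -subr_ge0 -(pmulr_rge0 _ ygt0).
by move: h; congr (_ <= _); ring.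
Qed.

Lemma Cauchy_Schwarz {R : realType} {n : nat} (x y : 'cV[R]_n) :
  `|dot x y| <= enorm x * enorm y.
Proof.
by rewrite -sqrtrM ?dot_ge0// -sqrtr_sqr ler_wsqrtr// Cauchy_Schwarz_sqr.
Qed.

Lemma opnorm_rank1 {R : realType} {m n : nat} (y : 'cV[R]_m) (x : 'cV[R]_n) :
  opnorm (y *m x^T) = enorm y * enorm x.
Proof.
(* The supremum is bounded by Cauchy-Schwarz and attained at [x / |x|], or at
   any vector when [x = 0]. *)
have appE z : enorm (y *m x^T *m z) = `|dot x z| * enorm y.
  rewrite -enormZ -mulmxA; congr enorm.
  by rewrite [x^T *m z]mx11_scalar -dot_mulmx mul_mx_scalar.
have bnd : ubound [set enorm (y *m x^T *m z) |
    z in [set z : 'cV[R]_n | enorm z <= 1]] (enorm y * enorm x).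
  move=> _ [z /= z1 <-]; rewrite appE mulrC ler_wpM2l ?enorm_ge0//.
  by rewrite (le_trans (Cauchy_Schwarz _ _))// ler_piMr// enorm_ge0.
apply/eqP; rewrite eq_le; apply/andP; split.
  apply: ge_sup => //; exists 0, 0; first by rewrite /= enorm0 ler01.
  by rewrite mulmx0 enorm0.
apply: ub_le_sup; first by exists (enorm y * enorm x).
have [->|xn0] := eqVneq x 0.
  exists 0; first by rewrite /= enorm0 ler01.
  by rewrite mulmx0 !enorm0 mulr0.
have xgt0 : 0 < enorm x by rewrite lt_def enorm_eq0 xn0 enorm_ge0.
exists ((enorm x)^-1 *: x) => /=.
  by rewrite enormZ ger0_norm ?invr_ge0 ?enorm_ge0// mulVf// gt_eqF.
rewrite appE dotZr -sqr_enorm expr2 mulrA mulVf ?gt_eqF// mul1r.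
by rewrite ger0_norm ?enorm_ge0// mulrC.
Qed.

(** * The error of a dual pair and its lower bound *)

(** The matrices [delta_mx i i] are pairwise distinct, so a sum over the set of
    them is a sum over the indices. *)
Lemma error1E {R : realType} {N n : nat} (p : R) (F G : 'I_N -> 'cV[R]_n) :
  error1 p F G =
  (N%:R^-1 * \sum_(i < N) (enorm (G i) * enorm (F i)) `^ p) `^ p^-1.
Proof.
congr ((_ * _) `^ _); rewrite fsbig_image; last first.
  move=> i j _ _ /matrixP /(_ i i); rewrite !mxE !eqxx/=.
  by have [//|_ /eqP] := eqVneq i j; rewrite oner_eq0.
rewrite [RHS](fsbig_seq _ _ (index_enum_uniq 'I_N)).
rewrite (_ : [set` index_enum 'I_N] = setT); last first.
  by apply/seteqP; split=> i //= _; rewrite mem_index_enum.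
apply: eq_fsbigr => i _; congr (_ `^ _); rewrite -opnorm_rank1; congr opnorm.
apply/matrixP => j k; rewrite -(mul_delta_mx (0 : 'I_1)) mulmxA -mulmxA.
rewrite -colE -rowE !mxE; apply: eq_bigr => l _.
by rewrite !mxE ord1.
Qed.

(** A sequence of mean at least [m] has a power mean of exponent [p] at least
    [m]; the bound is stated on the sum of the sequence. *)
Lemma power_mean {R : realType} {N : nat} {p m : R} {a : 'I_N -> R} :
  (0 < N)%N -> 1 < p -> 0 <= m -> (forall i, 0 <= a i) ->
  N%:R * m <= \sum_(i < N) a i ->
  m <= (N%:R^-1 * \sum_(i < N) a i `^ p) `^ p^-1.
Proof.
move=> N0 p1 m0 a0 ma; have p0 : 0 < p by lra.
have pm0 : 0 < p - 1 by lra.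
have NR : 0 < N%:R :> R by rewrite ltr0n.
(* t ^ p lies above its tangent line at m: Young's inequality applied to t
   and m ^ (p - 1), with conjugate exponents p and p / (p - 1) *)
have tangent t : 0 <= t -> m `^ p + p * m `^ (p - 1) * (t - m) <= t `^ p.
  move=> t0; have := @conjugate_powR R t (m `^ (p - 1)) p (p / (p - 1)).
  rewrite -powRrM mulrCA mulfV ?gt_eqF// mulr1 => /(_ t0 (powR_ge0 _ _) p0).
  have pq1 : p^-1 + (p / (p - 1))^-1 = 1 by field; rewrite !gt_eqF.
  move=> /(_ (divr_gt0 p0 pm0) pq1).
  rewrite -(ler_pM2l p0) => h; rewrite -subr_ge0; rewrite -subr_ge0 in h.
  move: h; congr (_ <= _).
  by rewrite -(mulr_powRB1 m0 p0); field; rewrite !gt_eqF.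
have -> : m = (m `^ p) `^ p^-1.
  by rewrite -powRrM mulfV ?gt_eqF// powRr1.
apply: ge0_ler_powR; rewrite ?nnegrE ?powR_ge0 ?invr_ge0 ?(ltW p0)//.
  by rewrite mulr_ge0 ?invr_ge0 ?ler0n// sumr_ge0// => i _; rewrite powR_ge0.
rewrite -(ler_pM2l NR) mulrA mulfV ?gt_eqF// mul1r.
apply: le_trans (ler_sum _ (fun i _ => tangent _ (a0 i))).
rewrite big_split/= sumr_const card_ord mulr_natl.
rewrite lerDl -mulr_sumr.
rewrite mulr_ge0 ?mulr_ge0 ?powR_ge0 ?(ltW p0)// sumrB sumr_const card_ord.
by rewrite -mulr_natl subr_ge0.
Qed.

Lemma dual_pair_trace {R : realType} {N n : nat} {F G : 'I_N -> 'cV[R]_n} :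
  dual_pair F G -> \sum_(i < N) dot (F i) (G i) = n%:R.
Proof.
case=> _ _ dFG.
(* the reconstruction formula on the standard basis *)
have id : (analysis_op G)^T *m analysis_op F = 1%:M.
  apply/matrixP => j k; have := dFG (delta_mx k 0).
  move=> /colP /(_ j); rewrite !mxE summxE eqxx andbT => ->.
  apply: eq_bigr => i _; rewrite !mxE mulrC; congr (_ * _).
  by rewrite /dot (bigD1 k)//= big1 => [|l lk];
    rewrite ?mxE ?eqxx ?mul1r ?addr0// (negbTE lk) mul0r.
rewrite -[n%:R](mxtrace1 R n) -id /mxtrace exchange_big/=.
by apply: eq_bigr => j _; rewrite mxE; apply: eq_bigr => i _; rewrite !mxE mulrC.
Qed.

Lemma dual_pair_error1_ge {R : realType} {N n : nat} {p : R}
    {F G : 'I_N -> 'cV[R]_n} :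
  (0 < N)%N -> 1 < p -> dual_pair F G -> n%:R / N%:R <= error1 p F G.
Proof.
move=> N0 p1 dFG; rewrite error1E; apply: power_mean => //.
- by rewrite divr_ge0// ler0n.
- by move=> i; rewrite mulr_ge0// enorm_ge0.
rewrite mulrC divfK ?pnatr_eq0 -?lt0n// -(dual_pair_trace dFG).
apply: ler_sum => i _; rewrite mulrC; apply: le_trans (Cauchy_Schwarz _ _).
exact: ler_norm.
Qed.

(** * Tight frames *)

Lemma quadratic_form_eq0 {R : realType} {n : nat} (T : 'M[R]_n) :
  T^T = T -> (forall x, dot x (T *m x) = 0) -> T = 0.
Proof.
move=> Tsym T0.
(* [T] is recovered by polarization on the standard basis *)
have Te j k : dot (delta_mx j 0) (T *m delta_mx k 0) = T j k.
  by rewrite dot_mulmx trmx_delta mulmxA -rowE -colE !mxE.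
apply/matrixP => j k; rewrite mxE.
have := T0 (delta_mx j 0 + delta_mx k 0).
rewrite mulmxDr !(dotDl, dotDr) !T0 !Te.
have -> : T k j = T j k by rewrite -{1}Tsym mxE.
lra.
Qed.

Lemma tight_frame_op {R : realType} {N n : nat} {F : 'I_N -> 'cV[R]_n} {A : R} :
  frame_bounds F A A -> frame_op F = A%:M.
Proof.
move=> tF; apply/eqP; rewrite -subr_eq0; apply/eqP.
apply: quadratic_form_eq0 => [|x].
  by rewrite linearB/= tr_scalar_mx /frame_op trmx_mul trmxK.
have := tF x; rewrite -eq_le => /eqP xA.
rewrite mulmxBl mul_scalar_mx -scaleNr dotDr dotZr mulNr -sqr_enorm xA.
apply/eqP; rewrite subr_eq0; apply/eqP.
rewrite dot_mulmx /frame_op -mulmxA analysis_opE mulmxA -trmx_mul analysis_opE.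
rewrite -dot_mulmx; apply: eq_bigr => i _.
by rewrite !mxE real_normK ?num_real// expr2.
Qed.

Lemma tight_canonical_dual {R : realType} {N n : nat} {F : 'I_N -> 'cV[R]_n}
    {A : R} (i : 'I_N) :
  frame_bounds F A A -> canonical_dual F i = A^-1 *: F i.
Proof.
move=> tF; rewrite /canonical_dual (tight_frame_op tF) invmx_scalar.
exact: mul_scalar_mx.
Qed.

Lemma tight_dual_pair {R : realType} {N n : nat} {F : 'I_N -> 'cV[R]_n}
    {A : R} :
  0 < A -> frame_bounds F A A -> dual_pair F (canonical_dual F).
Proof.
move=> A0 tF; split.
- by exists A, A.
- exists A^-1, A^-1; split; rewrite ?invr_gt0// => f.
  have := tF f; rewrite -eq_le => /eqP fA; rewrite -eq_le; apply/eqP.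
  under eq_bigr do rewrite (tight_canonical_dual _ tF) dotZr normrM exprMn.
  rewrite -mulr_sumr -fA real_normK ?num_real//.
  by field; rewrite gt_eqF.
- move=> f.
  under eq_bigr do rewrite (tight_canonical_dual _ tF) scalerA mulrC -scalerA.
  rewrite -scaler_sumr.
  have -> : \sum_i dot f (F i) *: F i = frame_op F *m f.
    rewrite /frame_op -mulmxA analysis_opE synthesis_opE.
    by apply: eq_bigr => i _; rewrite mxE.
  by rewrite (tight_frame_op tF) mul_scalar_mx scalerA mulVf ?gt_eqF// scale1r.
Qed.

(** * Tight Laplacian frames *)

Lemma laplacian_ones {R : realType} {N : nat} (e : rel 'I_N) :
  laplacian R e *m const_mx 1 = 0 :> 'cV_N.
Proof.
rewrite mulmxBl mul_diag_mx; apply/colP => i; rewrite !mxE mulr1.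
rewrite -sum1_card natr_sum big_mkcond/= -sumrB big1// => j _.
by rewrite !mxE mulr1 inE/=; case: (e i j); rewrite subrr.
Qed.

(** With [n + 1] vertices and dimension [n], the vectors of a tight Laplacian
    frame all have the same norm. *)
Lemma tight_laplacian_frame_norm {R : realType} {n : nat} {e : rel 'I_n.+1}
    {F : 'I_n.+1 -> 'cV[R]_n} {A : R} :
  laplacian_frame (leq_pred n.+1) e F -> 0 < A -> frame_bounds F A A ->
  forall i, dot (F i) (F i) = A * (n%:R / n.+1%:R).
Proof.
case=> _ _ _ [M [lam [MMT _ Lspec FB]]] A0 tF i.
have MTM := mulmx1C MMT.
pose w := widen_ord (leq_pred n.+1).
have FE k j : F k j 0 = Num.sqrt (lam 0 (w j)) * M k (w j).
  by rewrite FB -colE mul_diag_mx !mxE.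
(* The (j, j) entry of the frame operator is the square of the truncated square
   root of lambda_j; this being A > 0, lambda_j is positive and equals A.  No
   positivity of the Laplacian is needed. *)
have lamA j : lam 0 (w j) = A.
  have sA : Num.sqrt (lam 0 (w j)) ^+ 2 = A.
    have := congr1 (fun T : 'M_n => T j j) (tight_frame_op tF).
    rewrite !mxE eqxx mulr1n => <-.
    have := congr1 (fun T : 'M_n.+1 => T (w j) (w j)) MTM.
    rewrite !mxE eqxx mulr1n => /(congr1 ( *%R (Num.sqrt (lam 0 (w j)) ^+ 2))).
    rewrite mulr1 => <-; rewrite mulr_sumr.
    by apply: eq_bigr => k _; rewrite !mxE FE; ring.
  rewrite -sA sqr_sqrtr//; apply: contraTT A0; rewrite -ltNge -leNgt => lt0.
  by rewrite -sA ler0_sqrtr ?expr0n// ltW.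
(* coordinates of the constant vector 1 in the eigenbasis: only the last one,
   on the kernel of the Laplacian, is nonzero *)
pose c : 'cV[R]_n.+1 := M^T *m const_mx 1.
have Mc : M *m c = const_mx 1 by rewrite mulmxA MMT mul1mx.
have c0 j : c (w j) 0 = 0.
  have : diag_mx lam *m c = 0.
    have := laplacian_ones (R := R) e; rewrite Lspec -!mulmxA -/c => LM.
    by rewrite -[LHS]mul1mx -MTM -mulmxA LM mulmx0.
  move=> /colP /(_ (w j)); rewrite mul_diag_mx !mxE lamA => /eqP.
  by rewrite mulf_eq0 gt_eqF//= => /eqP.
have Mlast k : M k ord_max * c ord_max 0 = 1.
  move/colP: Mc => /(_ k); rewrite mxE [RHS]mxE big_ord_recr/=.
  rewrite big1 ?add0r// => j _.
  by rewrite (_ : widen_ord _ j = w j) ?c0 ?mulr0//; apply: val_inj.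
have clast : c ord_max 0 ^+ 2 = n.+1%:R.
  have cE : c ord_max 0 = \sum_(k < n.+1) M k ord_max.
    by rewrite mxE; apply: eq_bigr => k _; rewrite !mxE mulr1.
  rewrite expr2 {1}cE mulr_suml.
  under eq_bigr do rewrite Mlast.
  by rewrite sumr_const card_ord.
have Msq : M i ord_max ^+ 2 = n.+1%:R^-1.
  rewrite -clast; apply: (mulIf (_ : c ord_max 0 ^+ 2 != 0)).
    by rewrite clast pnatr_eq0.
  by rewrite -exprMn Mlast expr1n mulVf// clast pnatr_eq0.
have rowi : \sum_(j < n) M i (w j) ^+ 2 = 1 - n.+1%:R^-1.
  have := congr1 (fun T : 'M_n.+1 => T i i) MMT.
  rewrite !mxE eqxx mulr1n big_ord_recr/= mxE -expr2 Msq => /(canRL (addrK _)) <-.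
  apply: eq_bigr => j _; rewrite mxE -expr2.
  by congr (M i _ ^+ 2); apply: val_inj.
transitivity (\sum_(j < n) A * M i (w j) ^+ 2).
  apply: eq_bigr => j _.
  by rewrite FE -expr2 exprMn sqr_sqrtr lamA// ltW.
rewrite -mulr_sumr rowi; congr (A * _).
by rewrite -natr1; field; rewrite natr1 pnatr_eq0.
Qed.

Theorem theorem5p3 (R : realType) (p : R) (hp : 1 < p) (N : nat)
    (e : rel 'I_N) (he : simple_graph e) (hconn : connected_graph e)
    (F : 'I_N -> 'cV[R]_(N.-1))
    (hF : laplacian_frame (leq_pred N) e F)
    (htight : tight_frame F) :
  optimal_pairs1 N N.-1 p (F, canonical_dual F).
Proof.
case: htight => A A0 tF; have dF := tight_dual_pair A0 tF.
have [N0 _] := hconn; have p0 : 0 < p by lra.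
have nF i : enorm (canonical_dual F i) * enorm (F i) = N.-1%:R / N%:R.
  rewrite (tight_canonical_dual _ tF) enormZ -mulrA -expr2 sqr_enorm.
  case: N N0 e F hF tF i {he hconn dF} => // n _ e F hF tF i.
  rewrite (tight_laplacian_frame_norm hF A0 tF) gtr0_norm ?invr_gt0//.
  by rewrite mulrA mulVf ?gt_eqF// mul1r.
have eF : error1 p F (canonical_dual F) = N.-1%:R / N%:R.
  rewrite error1E; under eq_bigr do rewrite nF.
  rewrite sumr_const card_ord -[X in _ * X]mulr_natl mulKf ?pnatr_eq0 -?lt0n//.
  by rewrite -powRrM mulfV ?gt_eqF// powRr1// divr_ge0// ler0n.
split=> //=; apply/eqP; rewrite eq_le; apply/andP; split.
  apply: lb_le_inf.
    by exists (error1 p F (canonical_dual F)), (F, canonical_dual F).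
  by move=> _ [[F' G'] /= d <-]; rewrite eF; apply: dual_pair_error1_ge.
apply: ge_inf; last by exists (F, canonical_dual F).
exists (N.-1%:R / N%:R) => _ [[F' G'] /= d <-].
exact: dual_pair_error1_ge.
Qed.
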